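(* Suppose that $$H(\theta) > \theta h_m+\left(p' \int_{0}^1 D^{p'-1}(u)\, g(u) \,\mathrm{d} u\right)^{\frac{1}{p'}}$$ and $h_m=h(0)$. Then the boundary value problem $$\begin{cases}\left(D(u)|u'|^{p-2}u'\right)' +\left(c+h(u)\right)u' +g(u)=0 \quad \text{on } \mathbb{R},\\ u(-\infty)=1,\quad u(+\infty)=0\end{cases}$$ has no solution (in the sense defined in the context) for any $c\in\mathbb{R}$.
   Context: Standing assumptions and notation. $p>1$ is real and $p'=\frac{p}{p-1}$. $D\in C^1(0,1)$ with $D>0$ in $(0,1)$ ($D$ may degenerate or be singular at $0$ and/or $1$). $h\in C[0,1]$, $H(u)=\int_0^u h(s)\,\mathrm{d}s$ (so $H\in C^1[0,1]$, $H(0)=0$), and $h_m=\min_{u\in[0,1]}h(u)$. $\theta\in(0,1)$, and $g\in C[0,1]$ satisfies $g=0$ in $[0,\theta]$, $g>0$ in $(\theta,1)$, $g(1)=0$. It is assumed that $\int_0^1 D^{p'-1}(u)g(u)\,\mathrm{d}u<+\infty$. Definition of solution. For given $c\in\mathbb{R}$, a continuous function $u:\mathbb{R}\to[0,1]$ is a solution of the boundary value problem if: (a) $u\in C^1(I_u)$, where $I_u=\{\xi\in\mathbb{R}: 0<u(\xi)<1\}$, and the equation holds at every point of $I_u$ (in particular $\xi\mapsto D(u(\xi))|u'(\xi)|^{p-2}u'(\xi)$ belongs to $C^1(I_u)$); (b) the function $\xi\mapsto D(u(\xi))|u'(\xi)|^{p-2}u'(\xi)$ (understood as $0$ at points where $u\in\{0,1\}$)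 is continuous on $\mathbb{R}$, and $D(u(\xi))|u'(\xi)|^{p-2}u'(\xi)\to 0$ as $u(\xi)\to 0$ and as $u(\xi)\to 1$; (c) $u(\xi)\to 1$ as $\xi\to-\infty$ and $u(\xi)\to 0$ as $\xi\to+\infty$. *)

(* Defs.v *)
From HB Require Import structures.
From mathcomp Require Import all_boot all_order all_algebra.
From mathcomp Require Import all_classical all_reals all_analysis.

Set Implicit Arguments.
Unset Strict Implicit.
Unset Printing Implicit Defensive.

Import Order.TTheory GRing.Theory Num.Theory.
Import numFieldNormedType.Exports.

Local Open Scope classical_set_scope.
Local Open Scope ring_scope.

(* All functions are total on R; the data D, h, g are only constrained on     *)
(* (0,1) or [0,1] and their values elsewhere are irrelevant.                  *)

(* Meant for open sets A. *)
Definition C1_on (R : realType) (A : set R) (f : R -> R) : Prop :=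
  forall x, A x -> derivable f x 1 /\ {for x, continuous (derive1 f)}.

Definition is_min_on (R : realType) (A : set R) (f : R -> R) (m : R) : Prop :=
  (exists2 x, A x & f x = m) /\ (forall x, A x -> m <= f x).

Definition conj_exp (R : realType) (p : R) : R := p / (p - 1).

Definition primitive (R : realType) (h : R -> R) (u : R) : R :=
  \int[@lebesgue_measure R]_(s in `[0, u]) h s.

Definition Dg (R : realType) (p : R) (D g : R -> R) (u : R) : R :=
  D u `^ (conj_exp p - 1) * g u.

Definition interior_set (R : realType) (u : R -> R) : set R :=
  [set xi | 0 < u xi < 1].

(* The test on u implements the convention that the flux is 0 where u is 0 or *)
(* 1, where neither D (u xi) nor u' need make sense. Where u' = 0 the product *)
(* is 0 for every p > 1, since the library's power is total.                  *)
Definition flux (R : realType) (p : R) (D u : R -> R) (xi : R) : R :=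
  if 0 < u xi < 1
  then D (u xi) * (`|derive1 u xi| `^ (p - 2)) * derive1 u xi
  else 0.

(* The flux tends to 0 as u tends to a, uniformly in the position xi. *)
Definition flux_vanishes_at (R : realType) (p : R) (D u : R -> R) (a : R) :
    Prop :=
  forall e : R, 0 < e -> exists2 d : R, 0 < d &
    forall xi : R, `|u xi - a| < d -> `|flux p D u xi| < e.

Record is_solution (R : realType) (p : R) (D h g : R -> R) (c : R)
    (u : R -> R) : Prop := IsSolution {
  sol_range : forall xi, 0 <= u xi <= 1;
  sol_continuous : continuous u;
  sol_C1 : C1_on (interior_set u) u;
  sol_flux_C1 : C1_on (interior_set u) (flux p D u);
  sol_equation : forall xi, interior_set u xi ->
    derive1 (flux p D u) xi + (c + h (u xi)) * derive1 u xi + g (u xi) = 0;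
  sol_flux_continuous : continuous (flux p D u);
  sol_flux_0 : flux_vanishes_at p D u 0;
  sol_flux_1 : flux_vanishes_at p D u 1;
  sol_ninfty : u xi @[xi --> -oo] --> (1 : R);
  sol_pinfty : u xi @[xi --> +oo] --> (0 : R)
}.

(* Main.v *)
Require Import Defs.
From HB Require Import structures.
From mathcomp Require Import all_boot all_order all_algebra.
From mathcomp Require Import all_classical all_reals all_analysis.
From mathcomp Require Import ring lra.

(* Write phi for the flux, p' for the conjugate exponent, H for the primitive of h
   and G for that of D^(p'-1) g. As g vanishes on [0, theta], phi + c u + H(u) is
   constant once u stays below theta, and it tends to 0 at +oo, so it is 0 there.
   At the last time u equals a small v, u' <= 0; hence c v + H(v) >= 0, and
   v -> 0 gives c >= - h(0) = - h_m, i.e. c + h >= 0 on [0, 1]. Therefore the energy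
   |phi|^p' / p' + G(u) is nonincreasing while phi <> 0. Starting it, far to the
   left, from a point where |phi| is arbitrarily small yields
   |phi|^p' <= p' G(1) everywhere. At the last time u equals theta this reads
   (c theta + H(theta))^p' <= p' G(1), which contradicts the hypothesis since
   c theta >= - theta h_m. *)

Set Implicit Arguments.
Unset Strict Implicit.
Unset Printing Implicit Defensive.

Import Order.TTheory GRing.Theory Num.Theory.
Import numFieldNormedType.Exports.

Local Open Scope classical_set_scope.
Local Open Scope ring_scope.

(** * Level crossings and one-variable calculus *)

(** The level set of v in [a, b] is compact, and nonempty by the intermediate value theorem; t is
    its largest element, since a value above v after t would force a later crossing. *)
Lemma last_crossing (R : realType) (f : R -> R) (a b v : R) :
  a <= b -> continuous f -> f b <= v <= f a ->
  exists t, [/\ a <= t <= b, f t = v & forall x, t <= x <= b -> f x <= v].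
Proof.
move=> ab cf fv.
have ivt x : x <= b -> v <= f x -> exists2 t, x <= t <= b & f t = v.
  move=> xb vx; have /andP[fb _] := fv.
  have [||t] := @IVT R f x b v xb; first exact: continuous_subspaceT.
    by rewrite ge_min le_max fb vx orbT.
  by rewrite in_itv/= => tI ft; exists t.
pose A := `[a, b] `&` f @^-1` [set v].
have [|||t] := @compact_EVT_max _ R id A.
- by have [|t tI ft] := ivt a ab; [by case/andP: fv|exists t; split].
- apply: (@subclosed_compact _ _ `[a, b]).
  + apply: closedI; first exact: itv_closed.
    by apply: closed_comp => [x _|]; [exact: cf|exact: closed_eq].
  + exact: segment_compact.
  + by move=> x [].
- by apply: continuous_subspaceT => x; exact: cvg_id.
rewrite inE => -[/= tab ft] tmax; exists t; split => //.
move=> x /andP[tx xb]; rewrite leNgt; apply/negP => vx.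
have [s /andP[xs sb] fs] := ivt x xb (ltW vx).
have := tmax s; rewrite inE => /(_ _)/wrap[].
  split => //=; rewrite in_itv/= sb andbT (le_trans _ xs)// (le_trans _ tx)//.
  by move: tab; rewrite /= in_itv/= => /andP[].
move=> st; have tE : x = t by apply/eqP; rewrite eq_le tx (le_trans xs).
by move: vx; rewrite tE ft ltxx.
Qed.

Lemma is_derive_derive1 (R : realType) (f : R -> R) (x : R) :
  derivable f x 1 -> is_derive x 1 f (derive1 f x).
Proof. by move=> df; rewrite derive1E; split. Qed.

Lemma is_derive_continuous (R : realType) (f : R -> R) (x l : R) :
  is_derive x 1 f l -> {for x, continuous f}.
Proof. by case=> df _; apply/differentiable_continuous/derivable1_diffP. Qed.

Lemma is_derive0_segment (R : realType) (f : R -> R) (a b : R) : a <= b ->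
  (forall x, a <= x <= b -> is_derive x 1 f 0) -> f a = f b.
Proof.
move=> ab f0; have [||c _] := @MVT_segment R f (cst 0) a b ab.
- by move=> x; rewrite in_itv/= => /andP[/ltW ax /ltW xb]; apply: f0; rewrite ax.
- apply: continuous_in_subspaceT => x; rewrite inE /= in_itv/= => xab.
  exact: is_derive_continuous (f0 x xab).
- by rewrite mul0r => /eqP; rewrite subr_eq0 => /eqP.
Qed.

(** If F a were nonzero, F would be constant until |F| first falls to |F a| / 2, which is absurd.
    The derivative is required only where F is nonzero because the differential equation is
    available only where 0 < u < 1. *)
Lemma eq0_of_vanishing_at_infinity (R : realType) (F : R -> R) (a : R) :
  continuous F -> (forall x, a <= x -> F x != 0 -> is_derive x 1 F 0) ->
  (forall e, 0 < e -> exists2 x, a <= x & `|F x| <= e) -> F a = 0.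
Proof.
move=> cF dF Fy; apply/eqP/negP => /negP Fa0.
have Fa_gt0 : 0 < `|F a| by rewrite normr_gt0.
have [|y ay Fye] := Fy (`|F a| / 2); first by rewrite divr_gt0.
(* The reflection x -> -x turns the last crossing into a first one: -t is the first point from a on
   where |F| equals |F a| / 2. *)
have [|||t [/andP[yt ta] Ft tmax]] :=
  @last_crossing R (fun x => - `|F (- x)|) (- y) (- a) (- (`|F a| / 2)).
- by rewrite lerN2.
- move=> x; apply: cvgN; apply: cvg_norm; apply: (@cvg_comp _ _ _ -%R F).
    exact: opp_continuous.
  exact: cF.
- by rewrite !opprK !lerN2 Fye andbT; lra.
have : F a = F (- t).
  apply: is_derive0_segment => [|x /andP[ax xt]]; first by rewrite lerNr.
  apply: dF => //; rewrite -normr_gt0.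
  have := tmax (- x); rewrite opprK lerN2 => /(_ _)/wrap[]; first by lra.
  by move=> h; lra.
by move: Ft => /oppr_inj + FaE; rewrite -FaE; lra.
Qed.

(** Right difference quotients are nonpositive. The hypothesis is one-sided because the last time at
    a level controls u only afterwards. *)
Lemma derive1_le0_right_max (R : realType) (f : R -> R) (t d : R) :
  0 < d -> derivable f t 1 -> (forall x, t < x < t + d -> f x <= f t) ->
  derive1 f t <= 0.
Proof.
move=> d0 dft ft; rewrite derive1E /derive.
rewrite cvg_at_rightE; last exact: dft.
apply: limr_le.
  have /cvg_ex[l hl] := dft; apply/cvg_ex; exists l.
  exact: cvg_dnbhs_at_right.
near=> e; rewrite /= scaler1.
have e0 : 0 < e by near: e; exact: nbhs_right_gt.
have ed : e < d by near: e; exact: nbhs_right_lt.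
rewrite pmulr_rle0 ?invr_gt0// subr_le0; apply: ft; lra.
Unshelve. all: by end_near. Qed.

(** * Powers and the conjugate exponent *)

Lemma is_derive_norm_powR (R : realType) (f : R -> R) (x df q : R) :
  f x != 0 -> is_derive x 1 f df ->
  is_derive x 1 (fun y => `|f y| `^ q) (q * (`|f x| `^ (q - 2) * f x * df)).
Proof.
move=> fx0 fdf.
(* Rewriting |z|^r as (z^2)^(r/2) avoids differentiating the norm. *)
have sqE z r : `|z| `^ r = (z ^+ 2) `^ (r / 2).
  rewrite -real_normK ?num_real// -powR_mulrn// -powRrM; congr (_ `^ _).
  by field.
have -> : (fun y => `|f y| `^ q) = ((@powR R)^~ (q / 2)) \o (f ^+ 2).
  by apply/funext => y; rewrite sqE.
have f2 : 0 < (f ^+ 2) x by rewrite exprfctE exprn_even_gt0.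
have df2 := @is_deriveX R _ f 2 x 1 df fdf.
apply: (is_derive_eq (is_derive1_comp (is_derive1_powR (q / 2) f2) df2)).
rewrite sqE /= (_ : (q - 2) / 2 = q / 2 - 1); last by field.
by rewrite /GRing.scale/=; field.
Qed.

(** With d = D(u) and y = u', w is the flux. The powers of |y| cancel because (p - 1)(p' - 2) + (p -
    2) = 0. *)
Lemma powR_conj_exp (R : realType) (p d y : R) : 1 < p -> 0 < d -> y != 0 ->
  let w := d * `|y| `^ (p - 2) * y in
  `|w| `^ (conj_exp p - 2) * w = d `^ (conj_exp p - 1) * y.
Proof.
move=> p1 d0 y0 /=; have ny : 0 < `|y| by rewrite normr_gt0.
have wE : `|d * `|y| `^ (p - 2) * y| = d * `|y| `^ (p - 1).
  rewrite !normrM (gtr0_norm d0) (ger0_norm (powR_ge0 _ _)) -mulrA; congr (_ * _).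
  rewrite -[X in _ * X](powRr1 (ltW ny)) -powRD ?(gt_eqF ny) ?implybT//.
  by congr (_ `^ _); ring.
rewrite wE powRM ?powR_ge0 ?(ltW d0)// -powRrM mulrA mulrACA.
rewrite -[X in _ * X * _](powRr1 (ltW d0)) -!powRD ?(gt_eqF ny) ?(gt_eqF d0) ?implybT//.
rewrite [in X in _ * X * _](_ : _ + _ = 0) ?powRr0 ?mulr1; last first.
  by rewrite /conj_exp; field; lra.
by congr (_ `^ _ * _); ring.
Qed.

(** * Primitives of h and of the weighted reaction term *)

(* H is differentiable on both sides at the endpoints 0 and 1, unlike the primitive
   itself, whose values outside [0, 1] depend on junk values of h. *)
Lemma primitive_extension (R : realType) (h : R -> R) :
  {within `[0, 1], continuous h} ->
  exists H : R -> R, forall v : R, 0 <= v <= 1 ->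
    H v = primitive h v /\ is_derive v 1 H (h v).
Proof.
move=> ch.
(* The projection of the line onto [0, 1], written with absolute values so that its continuity is
   immediate. *)
pose clamp (x : R) : R := (`|x| - `|x - 1| + 1) / 2.
have clamp_itv x : 0 <= clamp x <= 1.
  by rewrite /clamp; case: (ger0P x); case: (ger0P (x - 1)) => ? ?; lra.
have clampE x : 0 <= x <= 1 -> clamp x = x.
  by rewrite /clamp; case: (ger0P x); case: (ger0P (x - 1)) => ? ? ?; lra.
have clamp_cont : continuous clamp.
  move=> x; apply: cvgM; last exact: cvg_cst.
  apply: cvgD; last exact: cvg_cst.
  apply: cvgB; first exact: norm_continuous.
  by apply: cvg_norm; apply: cvgB; [exact: cvg_id|exact: cvg_cst].
have hc_cont : continuous (h \o clamp).
  move=> x; move/subspace_continuousP : ch => /(_ (clamp x)).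
  rewrite /= in_itv/= => /(_ (clamp_itv x)) hx A /hx wA.
  apply: (@filterS _ (nbhs x) _ _ _ _ (clamp_cont x _ wA)) => y hy; apply: hy.
  by rewrite /= in_itv/= clamp_itv.
have hc_int a b : (@lebesgue_measure R).-integrable `[a, b] (EFin \o (h \o clamp)).
  apply: continuous_compact_integrable; first exact: segment_compact.
  exact: continuous_subspaceT.
(* Starting at -1 makes 0 an interior point, so the fundamental theorem of calculus also applies
   there; subtracting K 0 restores the primitive from 0. *)
pose K (v : R) : R := \int[@lebesgue_measure R]_(s in `[-1, v]) (h \o clamp) s.
exists (fun v => K v - K 0) => v v01; have /andP[v0 v1] := v01; split.
  rewrite /K /primitive (Rintegral_itvB (hc_int _ _)) ?bnd_simp//.
  rewrite Rintegral_itv_obnd_cbnd; last first.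
    by apply: integrableS (hc_int 0 v) => //; apply: subset_itvr; rewrite bnd_simp.
  apply: eq_Rintegral => s; rewrite inE /= in_itv/= => /andP[s0 sv].
  by rewrite clampE// s0 (le_trans sv).
have vlt : v < v + 1 by lra.
have mv : -1 < v by lra.
have [dK dKE] := continuous_FTC1_closed vlt (hc_int _ _) mv (hc_cont v).
rewrite -[X in is_derive _ _ _ X]subr0; apply: is_deriveB.
split; first exact: dK.
by rewrite -derive1E [LHS]dKE /= clampE.
Qed.

(** Finiteness of the integral replaces continuity at the endpoints, where f may blow up; the upper
    bound on G is the nonnegativity of the integral over ]v, b[. *)
Lemma ge0_primitive_oo (R : realType) (f : R -> R) (a b : R) :
  (forall x, a < x < b -> 0 <= f x) ->
  (forall x, a < x < b -> {for x, continuous f}) ->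
  (\int[@lebesgue_measure R]_(x in `]a, b[) (f x)%:E < +oo)%E ->
  exists G : R -> R, forall v, a < v < b -> is_derive v 1 G (f v) /\
    0 <= G v <= \int[@lebesgue_measure R]_(x in `]a, b[) f x.
Proof.
move=> f0 cf foo.
have fint : (@lebesgue_measure R).-integrable `]a, b[ (EFin \o f).
  apply/integrableP; split.
    apply/measurable_realfun.measurable_EFinP.
    apply: measurable_realfun.open_continuous_measurable_fun.
      exact: interval_open.
    by move=> x; rewrite inE /= in_itv/=; exact: cf.
  rewrite (_ : (\int[_]_(x in _) _)%E =
    (\int[@lebesgue_measure R]_(x in `]a, b[) (f x)%:E)%E)//.
  apply: eq_integral => x; rewrite inE /= in_itv/= => xab.
  by rewrite ger0_norm ?f0.
exists (fun v => \int[@lebesgue_measure R]_(x in `]a, v]) f x) => v /[dup] vab.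
move=> /andP[av vb].
(* The midpoint of v and b serves as a right end strictly beyond v. *)
have vI : (@lebesgue_measure R).-integrable `]a, (v + b) / 2] (EFin \o f).
  by apply: integrableS fint => //; apply: subset_itvl; rewrite bnd_simp; lra.
split.
  have vlt : v < (v + b) / 2 by lra.
  have avB : (BRight a < BRight v)%O by rewrite bnd_simp.
  have [dG dGE] := continuous_FTC1 vlt vI avB (cf v vab).
  by split; [exact: dG|rewrite -derive1E [LHS]dGE].
rewrite Rintegral_ge0/=; last first.
  by move=> x /=; rewrite in_itv/= => /andP[ax xv]; apply: f0; lra.
rewrite -subr_ge0 (Rintegral_itvB fint) ?bnd_simp ?(ltW av)//.
apply: Rintegral_ge0 => x /=; rewrite in_itv/= => /andP[vx xb].
by apply: f0; lra.
Qed.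

(** * The first integral and the lower bound on the speed *)

Lemma last_time_at_level (R : realType) (u : R -> R) (v : R) :
  continuous u -> u x @[x --> -oo] --> (1 : R) -> u x @[x --> +oo] --> (0 : R) ->
  0 < v < 1 -> exists2 t, u t = v & forall x, t <= x -> u x <= v.
Proof.
move=> cu uNy uy /andP[v0 v1].
have [A [_ hA]] := cvgr_gt _ uNy _ v1.
have [B [_ hB]] := cvgr_lt _ uy _ v0.
(* The unit shifts are needed because the limits give u > v only strictly before A, and u < v only
   strictly after B. *)
pose a := Num.min (A - 1) B; pose b := B + 1.
have aA : a < A by rewrite /a gt_min; apply/orP; left; lra.
have aB : a <= B by rewrite /a ge_min lexx orbT.
have Bb : B < b by rewrite /b; lra.
have [|//||t [/andP[_ tb] ut tmax]] := @last_crossing R u a b v.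
- lra.
- by rewrite (ltW (hB b Bb)) (ltW (hA a aA)).
- exists t => // x tx; have [xb|bx] := leP x b; first by apply: tmax; rewrite tx.
  by apply/ltW/hB; exact: lt_trans bx.
Qed.

Lemma flux_first_integral (R : realType) (p : R) (D h g : R -> R) (c : R)
    (u H : R -> R) (theta t : R) :
  is_solution p D h g c u ->
  (forall v : R, 0 <= v <= 1 -> is_derive v 1 H (h v)) -> H 0 = 0 ->
  theta < 1 -> (forall v : R, 0 <= v <= theta -> g v = 0) ->
  (forall x, t <= x -> u x <= theta) ->
  flux p D u t + (c * u t + H (u t)) = 0.
Proof.
move=> sol dH H0 theta1 g0 ule; have urange := sol_range sol.
pose M (v : R) := c * v + H v.
have cM v : 0 <= v <= 1 -> {for v, continuous M}.
  move=> v01; apply: cvgD; last exact: (is_derive_continuous (dH v v01)).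
  by apply: cvgMr; exact: cvg_id.
apply: (@eq0_of_vanishing_at_infinity R (fun x => flux p D u x + M (u x))).
- move=> x; apply: cvgD; first exact: sol_flux_continuous sol x.
  apply: (@continuous_comp _ _ _ u M x); first exact: sol_continuous sol x.
  exact: cM.
- move=> x tx Fx0; have /andP[ux0 ux1] := urange x.
  (* Where u = 0 the flux is 0 by convention and M 0 = 0, so a nonzero sum excludes that case. *)
  have uxI : 0 < u x < 1.
    rewrite (le_lt_trans (ule x tx))// andbT lt_neqAle ux0 andbT eq_sym.
    apply: contra Fx0 => /eqP ux; rewrite /flux ux ltxx/= add0r /M mulr0 add0r.
    by rewrite H0.
  have [duR _] := sol_C1 sol uxI; have [dfR _] := sol_flux_C1 sol uxI.
  have du := is_derive_derive1 duR.
  have df := is_derive_derive1 dfR.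
  have dF := is_deriveD df
    (is_deriveD (is_deriveZ c du) (is_derive1_comp (dH _ (urange x)) du)).
  apply: (is_derive_eq dF); rewrite -(sol_equation sol uxI) g0 ?ux0 ?ule//.
  by rewrite /GRing.scale/=; ring.
- move=> e e0; have e20 : 0 < e / 2 by lra.
  have [d1 d10 hd1] := sol_flux_0 sol e20.
  have M0 : M 0 = 0 by rewrite /M mulr0 add0r.
  have cM0 : M x @[x --> (0 : R)] --> (0 : R).
    by rewrite -[X in _ --> X]M0; apply: cM; rewrite lexx ler01.
  have /cvgrPdist_lt/(_ _ e20) := cvg_comp _ _ (sol_pinfty sol) cM0.
  move=> [B1 [_ hB1]].
  have /cvgrPdist_lt/(_ _ d10) [B2 [_ hB2]] := sol_pinfty sol.
  pose x := Num.max t (Num.max (B1 + 1) (B2 + 1)).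
  have tx : t <= x by rewrite /x le_max lexx.
  have B1x : B1 < x by rewrite /x !lt_max ltrDl ltr01 orbT.
  have B2x : B2 < x by rewrite /x !lt_max ltrDl ltr01 !orbT.
  exists x => //; apply: (le_trans (ler_normD _ _)).
  have := hB1 _ B1x; have := hB2 _ B2x; rewrite /= !sub0r !normrN => ux Mux.
  by have := hd1 x; rewrite subr0 => /(_ ux); lra.
Qed.

Lemma speed_ge (R : realType) (p : R) (D h g : R -> R) (c : R)
    (u H : R -> R) (theta : R) :
  is_solution p D h g c u -> (forall v : R, 0 < v < 1 -> 0 < D v) ->
  (forall v : R, 0 <= v <= 1 -> is_derive v 1 H (h v)) -> H 0 = 0 ->
  0 < theta < 1 -> (forall v : R, 0 <= v <= theta -> g v = 0) ->
  0 <= c + h 0.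
Proof.
move=> sol D0 dH H0 /andP[theta0 theta1] g0.
have M_ge0 v : 0 < v < theta -> 0 <= c * v + H v.
  move=> /andP[v0 vt]; have v1 : v < 1 by lra.
  have [|t ut tmax] := last_time_at_level (v := v) (sol_continuous sol)
    (sol_ninfty sol) (sol_pinfty sol); first by rewrite v0.
  have utI : 0 < u t < 1 by rewrite ut v0.
  have := flux_first_integral (t := t) sol dH H0 theta1 g0.
  rewrite ut => /(_ _)/wrap[x tx|].
    by apply: (le_trans (tmax x tx)); exact: ltW.
  have : derive1 u t <= 0.
    apply: (@derive1_le0_right_max R u t 1) => //.
      by have [] := sol_C1 sol utI.
    by move=> x /andP[/ltW tx _]; rewrite ut; exact: tmax.
  rewrite /flux utI => du.
  have : D (u t) * `|derive1 u t| `^ (p - 2) * derive1 u t <= 0.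
    by rewrite mulr_ge0_le0// mulr_ge0 ?powR_ge0// ltW// D0.
  by lra.
(* The function - (c v + H v) vanishes at 0 and is nonpositive just to the right, so its derivative
   - (c + h 0) at 0 is nonpositive. *)
have d0 : is_derive (0 : R) 1 (- (c \*: id + H)) (- (c + h 0)).
  have := is_deriveN (is_deriveD (is_deriveZ c (is_derive_id (0 : R) 1))
    (dH 0 _)).
  by rewrite /GRing.scale/= mulr1; apply; rewrite lexx ler01.
have := @derive1_le0_right_max R _ 0 theta theta0 (@ex_derive _ _ _ _ _ _ _ d0).
rewrite derive1E (@derive_val _ _ _ _ _ _ _ d0) oppr_le0; apply => v.
rewrite add0r => vt; rewrite /= !fctE /= /GRing.scale/= mulr0 H0 addr0 oppr0 oppr_le0.
exact: M_ge0.
Qed.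

(** * The energy estimate for the flux *)

(* By [powR_conj_exp], the derivative of the energy is
   - D (u)^(p' - 1) * (c + h (u)) * u'^2. *)
Lemma flux_energy_nonincreasing (R : realType) (p : R) (D h g : R -> R) (c : R)
    (u G : R -> R) (a b : R) :
  let q := conj_exp p in
  1 < p -> is_solution p D h g c u -> (forall v : R, 0 < v < 1 -> 0 < D v) ->
  (forall v : R, 0 < v < 1 -> is_derive v 1 G (Dg p D g v)) ->
  (forall v : R, 0 <= v <= 1 -> 0 <= c + h v) ->
  a <= b -> (forall x, a <= x <= b -> flux p D u x != 0) ->
  q^-1 * `|flux p D u b| `^ q + G (u b) <= q^-1 * `|flux p D u a| `^ q + G (u a).
Proof.
move=> q p1 sol D0 dG ch ab f0.
have q0 : q != 0 by rewrite mulf_neq0// ?invr_eq0; lra.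
pose E x : R := q^-1 * `|flux p D u x| `^ q + G (u x).
pose phi' x := derive1 (flux p D u) x.
pose E' x : R := q^-1 * (q * (`|flux p D u x| `^ (q - 2) * flux p D u x * phi' x)) +
  Dg p D g (u x) * derive1 u x.
have uI x : a <= x <= b -> 0 < u x < 1.
  by move/f0; rewrite /flux; case: ifP; rewrite // eqxx.
have dE x : a <= x <= b -> is_derive x 1 E (E' x).
  move=> xab; have uxI := uI x xab.
  have [duR _] := sol_C1 sol uxI; have [dfR _] := sol_flux_C1 sol uxI.
  have df := is_derive_norm_powR q (f0 x xab) (is_derive_derive1 dfR).
  have dGu := is_derive1_comp (dG _ uxI) (is_derive_derive1 duR).
  exact: (is_derive_eq (is_deriveD (is_deriveZ q^-1 df) dGu)).
have E'le0 x : a <= x <= b -> E' x <= 0.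
  move=> xab; have uxI := uI x xab; have Dx := D0 _ uxI.
  have u'0 : derive1 u x != 0.
    by have := f0 x xab; rewrite /flux uxI; apply: contra => /eqP ->; rewrite mulr0.
  have := powR_conj_exp p1 Dx u'0; rewrite -/q => fE.
  rewrite /E' {1 2}/flux uxI fE /Dg -/q mulKf//.
  have := sol_equation sol uxI; rewrite -/(phi' x) => eqn.
  (* The derivative is now D(u)^(q - 1) u' (phi' + g(u)); solving the equation for phi' cancels
     g. *)
  have -> : phi' x = - ((c + h (u x)) * derive1 u x + g (u x)) by lra.
  rewrite (_ : _ + _ =
    - (D (u x) `^ (q - 1) * ((c + h (u x)) * derive1 u x ^+ 2))); last by ring.
  rewrite oppr_le0 mulr_ge0 ?powR_ge0// mulr_ge0 ?sqr_ge0//.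
  by apply: ch; case/andP: uxI => /ltW -> /ltW ->.
apply: (@ler0_derive1_nincr R E a b) => //.
- move=> x; rewrite in_itv/= => /andP[/ltW ax /ltW xb].
  by apply: ex_derive; apply: dE; rewrite ax.
- move=> x; rewrite in_itv/= => /andP[/ltW ax /ltW xb].
  have xab : a <= x <= b by rewrite ax.
  by rewrite derive1E (@derive_val _ _ _ _ _ _ _ (dE x xab)) E'le0.
- apply: continuous_in_subspaceT => x; rewrite inE /= in_itv/= => xab.
  exact: is_derive_continuous (dE x xab).
Qed.

(** The energy decreases only while the flux is nonzero, so it is started not at -oo but at the last
    time before x when |flux| equals a small e > 0. *)
Lemma flux_bound (R : realType) (p : R) (D h g : R -> R) (c : R)
    (u G : R -> R) (T x : R) :
  let q := conj_exp p in
  1 < p -> is_solution p D h g c u -> (forall v : R, 0 < v < 1 -> 0 < D v) ->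
  (forall v : R, 0 < v < 1 -> is_derive v 1 G (Dg p D g v) /\ 0 <= G v <= T) ->
  (forall v : R, 0 <= v <= 1 -> 0 <= c + h v) ->
  `|flux p D u x| `^ q <= q * T.
Proof.
move=> q p1 sol D0 dG ch; rewrite leNgt; apply/negP => qT.
have q0 : 0 < q by rewrite divr_gt0; lra.
have T0 : 0 <= T.
  have [|_ /andP[]] := dG 2^-1; first by apply/andP; split; lra.
  exact: le_trans.
have qT0 : 0 <= q * T by rewrite mulr_ge0// ltW.
set m := `|flux p D u x| in qT.
(* Half of the supposed excess; e is chosen so that its q-th power is r. *)
pose r := (m `^ q - q * T) / 2.
have r0 : 0 < r by rewrite /r; lra.
pose e := r `^ q^-1.
have e0 : 0 < e by exact: powR_gt0.
have eq : e `^ q = r by rewrite /e -powRrM mulVf ?gt_eqF// powRr1// ltW.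
have em : e < m.
  rewrite ltNge; apply/negP => /(ge0_ler_powR (ltW q0)).
  rewrite !nnegrE normr_ge0 (ltW e0) eq => /(_ isT isT).
  by rewrite /r; lra.
have [d d0 hd] := sol_flux_1 sol e0.
have /cvgrPdist_lt/(_ _ d0) [A [_ hA]] := sol_ninfty sol.
pose s := Num.min (A - 1) x.
have sx : s <= x by rewrite /s ge_min lexx orbT.
have sA : s < A by rewrite /s gt_min; apply/orP; left; lra.
have fs : `|flux p D u s| < e by apply: hd; rewrite distrC; exact: hA.
(* The sign change makes |flux| at least e, hence nonzero, on all of [t, x]. *)
have [||t [/andP[_ tx] /oppr_inj ft tmax]] :=
    @last_crossing R (fun y => - `|flux p D u y|) s x (- e) sx.
- by move=> y; apply: cvgN; apply: cvg_norm; exact: sol_flux_continuous sol y.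
- by rewrite !lerN2 (ltW fs) (ltW em).
have fneq0 y : t <= y <= x -> flux p D u y != 0.
  by move=> /tmax; rewrite lerN2 -normr_gt0; exact: lt_le_trans.
have uI y : t <= y <= x -> 0 < u y < 1.
  by move/fneq0; rewrite /flux; case: ifP; rewrite // eqxx.
have := flux_energy_nonincreasing p1 sol D0 (fun v v01 => (dG v v01).1) ch tx fneq0.
rewrite -/q -/m ft eq.
have [|_ /andP[Gx _]] := dG (u x); first by rewrite uI// tx lexx.
have [|_ /andP[_ Gt]] := dG (u t); first by rewrite uI// tx lexx.
rewrite leNgt => /negP; apply.
(* Monotonicity and 0 <= G <= T give m^q <= r + q T, whereas m^q = q T + 2 r with r > 0. *)
have : q^-1 * (r + q * T) < q^-1 * m `^ q.
  by rewrite ltr_pM2l ?invr_gt0// /r; lra.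
by rewrite mulrDr mulKf ?gt_eqF//; lra.
Qed.

(** * Contradiction at the level theta *)

Theorem corollary2p5 (R : realType) (p : R) (D h g : R -> R) (theta hm : R)
  (p_gt1 : 1 < p)
  (D_C1 : C1_on `]0, 1[ D)
  (D_gt0 : forall u : R, 0 < u < 1 -> 0 < D u)
  (h_cont : {within `[0, 1], continuous h})
  (hm_min : is_min_on `[0, 1] h hm)
  (theta01 : 0 < theta < 1)
  (g_cont : {within `[0, 1], continuous g})
  (g_eq0 : forall u : R, 0 <= u <= theta -> g u = 0)
  (g_gt0 : forall u : R, theta < u < 1 -> 0 < g u)
  (g1 : g 1 = 0)
  (Dg_fin : (\int[@lebesgue_measure R]_(u in `]0%R, 1%R[) (Dg p D g u)%:E < +oo)%E)
  (H_theta : theta * hm +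
      (conj_exp p * \int[@lebesgue_measure R]_(u in `]0, 1[) Dg p D g u)
        `^ (1 / conj_exp p)
    < primitive h theta)
  (hm_h0 : hm = h 0) :
  forall c : R, ~ exists u : R -> R, is_solution p D h g c u.
Proof.
move=> c [u sol].
have [H HE] := primitive_extension h_cont.
have dH (v : R) : 0 <= v <= 1 -> is_derive v 1 H (h v) by move/HE => [].
have H0 : H 0 = 0.
  have [|-> _] := HE 0; first by rewrite lexx ler01.
  by rewrite /primitive set_itv1 Rintegral_set1.
have g_ge0 (v : R) : 0 < v < 1 -> 0 <= g v.
  move=> /andP[v0 v1]; have [vt|tv] := leP v theta; last by rewrite ltW// g_gt0 ?tv.
  by rewrite g_eq0// vt ltW.
have [G dG] : exists G : R -> R, forall v : R, 0 < v < 1 ->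
    is_derive v 1 G (Dg p D g v) /\
    0 <= G v <= \int[@lebesgue_measure R]_(x in `]0, 1[) Dg p D g x.
  apply: ge0_primitive_oo => // v v01.
    by rewrite mulr_ge0 ?powR_ge0 ?g_ge0.
  have vI : `]0, 1[%classic v by rewrite /= in_itv.
  apply: cvgM.
    have [dD _] := D_C1 v vI.
    exact: (is_derive_continuous (is_derive1_comp
      (is_derive1_powR (conj_exp p - 1) (D_gt0 v v01)) (is_derive_derive1 dD))).
  have [cg _ _] := (continuous_within_itvP g (@ltr01 R)).1 g_cont.
  by apply: cg; rewrite in_itv.
have ch0 := speed_ge sol D_gt0 dH H0 theta01 g_eq0.
(* As h attains its minimum at 0, the bound there extends to all of [0, 1]. *)
have ch (v : R) : 0 <= v <= 1 -> 0 <= c + h v.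
  move=> v01; have := hm_min.2 v; rewrite /= in_itv/= hm_h0 => /(_ v01).
  by lra.
have /andP[theta0 theta1] := theta01.
have [t ut ule] := last_time_at_level (sol_continuous sol)
  (sol_ninfty sol) (sol_pinfty sol) theta01.
have := flux_first_integral sol dH H0 theta1 g_eq0 ule.
have [|-> _] := HE (u t); first by rewrite ut !ltW.
rewrite ut => ft.
have := flux_bound t p_gt1 sol D_gt0 dG ch.
set q := conj_exp p; set qT := q * _; move=> fq.
have q0 : 0 < q by rewrite divr_gt0; lra.
have : `|flux p D u t| <= qT `^ (1 / q).
  rewrite -[leLHS]powRr1 ?normr_ge0// -[X in _ `^ X](mulfV (lt0r_neq0 q0)).
  rewrite powRrM div1r ge0_ler_powR// ?nnegrE ?powR_ge0 ?invr_ge0 ?(ltW q0)//.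
  exact: le_trans (powR_ge0 _ _) fq.
rewrite leNgt => /negP; apply.
(* Here - flux = c theta + H(theta) at t, and c theta >= - theta h(0). *)
have : - flux p D u t <= `|flux p D u t| by rewrite -normrN ler_norm.
have : 0 <= theta * (c + h 0) by rewrite mulr_ge0// ltW.
rewrite mulrDr; move: H_theta; rewrite -/q -/qT hm_h0; lra.
Qed.
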